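(* Let $(\mathfrak h,\mathfrak g,\mathfrak k)$ be a Manin triple over a field $\mathbb K$ of characteristic $2$ with (even) NIS $\mathscr B_{\mathfrak h}$. Let $\mathscr D\in\mathfrak{der}(\mathfrak h)_{\bar 1}$ and $a_0\in\mathfrak h_{\bar 0}$ satisfy $\mathscr B_{\mathfrak h}(\mathscr D(a),b)=\mathscr B_{\mathfrak h}(a,\mathscr D(b))$ for all $a,b\in\mathfrak h$, $\mathscr D^2=\mathrm{ad}_{a_0}$, $\mathscr D(a_0)=0$, and suppose $\mathscr D(\mathfrak k)\subseteq\mathfrak k$. Let $(\tilde{\mathfrak h}=\mathscr K\oplus\mathfrak h\oplus\mathscr K^*,\tilde{\mathscr B}_{\tilde{\mathfrak h}})$ be the double extension of $(\mathfrak h,\mathscr B_{\mathfrak h})$ by the one-dimensional Lie superalgebra $\mathscr K=\mathbb Kx$ ($x$ odd, $\mathscr K^*=\mathbb Kx^*$) by means of $\mathscr D$ and $a_0$. If $a_0\in\mathfrak k_{\bar 0}$, then $(\tilde{\mathfrak h},\tilde{\mathfrak g},\tilde{\mathfrak k})$ is a Manin triple with NIS $\tilde{\mathscr B}_{\tilde{\mathfrak h}}$, where $\tilde{\mathfrak g}=\mathscr K\oplus\mathfrak g$ and $\tilde{\mathfrak k}=\mathscr K^*\ltimes\mathfrak k$.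
   Context: All spaces are finite-dimensional. A Lie superalgebra in characteristic $2$ is a superspace $\mathfrak g=\mathfrak g_{\bar 0}\oplus\mathfrak g_{\bar 1}$ such that $\mathfrak g_{\bar 0}$ is a Lie algebra, $\mathfrak g_{\bar 1}$ is a $\mathfrak g_{\bar 0}$-module made two-sided by symmetry, together with a squaring $s_{\mathfrak g}:\mathfrak g_{\bar 1}\to\mathfrak g_{\bar 0}$ with $s_{\mathfrak g}(\lambda x)=\lambda^2 s_{\mathfrak g}(x)$ such that $[x,y]_{\mathfrak g}:=s_{\mathfrak g}(x+y)-s_{\mathfrak g}(x)-s_{\mathfrak g}(y)$ is bilinear on $\mathfrak g_{\bar 1}$, and $[s_{\mathfrak g}(x),y]_{\mathfrak g}=[x,[x,y]_{\mathfrak g}]_{\mathfrak g}$ for $x\in\mathfrak g_{\bar 1}$, $y\in\mathfrak g$. A derivation is a linear map $D$ with $D([x,y])=[D(x),y]+[x,D(y)]$ for $x\in\mathfrak g_{\bar 0},y\in\mathfrak g$ and $D(s_{\mathfrak g}(x))=[D(x),x]$ for $x\in\mathfrak g_{\bar 1}$; $\mathfrak{der}(\mathfrak g)_{\bar 1}$ denotes the odd ones. Sub-superalgebras are closed under bracket and squaring. NIS: a non-degenerate invariant ($\mathscr B([x,y],z)=\mathscr B(x,[y,z])$) symmetric bilinear form with $\mathscr B(x,x)=0$ for odd $x$. A Manin triple $(\mathfrak h,\mathfrak g,\mathfrak k)$: $\mathfrak h$ is a Lie superalgebra, $\mathfrak g,\mathfrak k$ are Lie sub-superalgebras with $\mathfrak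 h=\mathfrak g\oplus\mathfrak k$ as vector spaces, and there is an even NIS on $\mathfrak h$ for which $\mathfrak g$ and $\mathfrak k$ are isotropic. Double extension ($\mathscr D_{\bar 1}$-extension) of $(\mathfrak h,\mathscr B_{\mathfrak h})$ by means of $\mathscr D,a_0$: $\tilde{\mathfrak h}=\mathbb Kx\oplus\mathfrak h\oplus\mathbb Kx^*$ with $x,x^*$ odd, squaring $s_{\tilde{\mathfrak h}}(rx+a+tx^* )=s_{\mathfrak h}(a)+t^2a_0+t\mathscr D(a)$ ($a\in\mathfrak h_{\bar 1}$, $r,t\in\mathbb K$), bracket $[x,\tilde{\mathfrak h}]=0$, $[a,b]_{\tilde{\mathfrak h}}=[a,b]_{\mathfrak h}+\mathscr B_{\mathfrak h}(\mathscr D(a),b)x$, $[x^*,a]_{\tilde{\mathfrak h}}=\mathscr D(a)$ ($a,b\in\mathfrak h$), form $\tilde{\mathscr B}|_{\mathfrak h\times\mathfrak h}=\mathscr B_{\mathfrak h}$, $\tilde{\mathscr B}(\mathfrak h,x)=\tilde{\mathscr B}(\mathfrak h,x^* )=0$, $\tilde{\mathscr B}(x,x^* )=1$, $\tilde{\mathscr B}(x,x)=\tilde{\mathscr B}(x^*,x^* )=0$. This is an even NIS-Lie superalgebra. *)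

(* Defs.v *)
From HB Require Import structures.
From mathcomp Require Import all_boot all_order all_algebra.

Set Implicit Arguments.
Unset Strict Implicit.
Unset Printing Implicit Defensive.

Import GRing.Theory.
Local Open Scope ring_scope.

(* Raw data: a finite-dimensional space with two marked subspaces, a bracket
   and a squaring.  The squaring is a total function, but only its values on
   the odd part are meaningful: no definition below looks at other values. *)
Record superData (K : fieldType) := SuperData {
  carrier :> vectType K;
  even_part : {vspace carrier};
  odd_part : {vspace carrier};
  bracket : carrier -> carrier -> carrier;
  squaring : carrier -> carrier
}.
Arguments even_part {K} s.
Arguments odd_part {K} s.
Arguments bracket {K s}.
Arguments squaring {K s}.

Section SuperAlgebras.
Variables (K : fieldType) (h : superData K).
Implicit Types (g k : {vspace h}) (D : 'End(h)) (B : h -> h -> K).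

(* Lie superalgebra over a field of characteristic 2; the characteristic
   assumption itself is a hypothesis wherever the notion is used. *)
Record is_lie_superalgebra : Prop := IsLieSuperalgebra {
  superspace_full : (even_part h + odd_part h = fullv)%VS;
  superspace_direct : directv (even_part h + odd_part h);
  bracket_bilinear : bilinear_for *:%R *:%R (@bracket K h);
  bracket_even_even : forall a b : h, a \in even_part h -> b \in even_part h ->
    bracket a b \in even_part h;
  bracket_even_alt : forall a : h, a \in even_part h -> bracket a a = 0;
  bracket_even_jacobi : forall a b c : h,
    a \in even_part h -> b \in even_part h -> c \in even_part h ->
    bracket a (bracket b c) + bracket b (bracket c a)
      + bracket c (bracket a b) = 0;
  bracket_even_odd : forall a v : h, a \in even_part h -> v \in odd_part h ->
    bracket a v \in odd_part h;
  bracket_module : forall a b v : h,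
    a \in even_part h -> b \in even_part h -> v \in odd_part h ->
    bracket (bracket a b) v = bracket a (bracket b v) - bracket b (bracket a v);
  (* the module is made two-sided by symmetry, which costs no sign here *)
  bracket_odd_even : forall a v : h, a \in even_part h -> v \in odd_part h ->
    bracket v a = bracket a v;
  squaring_even : forall x : h, x \in odd_part h -> squaring x \in even_part h;
  squaringZ : forall (c : K) (x : h), x \in odd_part h ->
    squaring (c *: x) = c ^+ 2 *: squaring x;
  bracket_odd_odd : forall x y : h, x \in odd_part h -> y \in odd_part h ->
    bracket x y = squaring (x + y) - squaring x - squaring y;
  squaring_bracket : forall x y : h, x \in odd_part h ->
    bracket (squaring x) y = bracket x (bracket x y)
}.

Record is_lie_subsuperalgebra g : Prop := IsLieSubSuperalgebra {
  sub_graded : (g :&: even_part h + g :&: odd_part h = g)%VS;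
  sub_bracket : forall a b : h, a \in g -> b \in g -> bracket a b \in g;
  sub_squaring : forall x : h, x \in g -> x \in odd_part h -> squaring x \in g
}.

Record is_derivation D : Prop := IsDerivation {
  der_bracket : forall x y : h, x \in even_part h ->
    D (bracket x y) = bracket (D x) y + bracket x (D y);
  der_squaring : forall x : h, x \in odd_part h ->
    D (squaring x) = bracket (D x) x
}.

Definition is_odd_map D : Prop :=
  (D @: even_part h <= odd_part h)%VS /\ (D @: odd_part h <= even_part h)%VS.

Definition is_odd_derivation D : Prop := is_derivation D /\ is_odd_map D.

Record is_NIS B : Prop := IsNIS {
  nis_bilinear : bilinear_for *%R *%R B;
  nis_sym : forall a b : h, B a b = B b a;
  nis_odd : forall x : h, x \in odd_part h -> B x x = 0;
  nis_invariant : forall a b c : h, B (bracket a b) c = B a (bracket b c);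
  nis_nondegenerate : forall a : h, (forall b : h, B a b = 0) -> a = 0
}.

Definition is_even_form B : Prop :=
  forall a x : h, a \in even_part h -> x \in odd_part h ->
    B a x = 0 /\ B x a = 0.

Definition is_isotropic B g : Prop :=
  forall a b : h, a \in g -> b \in g -> B a b = 0.

Record is_manin_triple_with B g k : Prop := IsManinTripleWith {
  manin_lie : is_lie_superalgebra;
  manin_sub1 : is_lie_subsuperalgebra g;
  manin_sub2 : is_lie_subsuperalgebra k;
  manin_full : (g + k = fullv)%VS;
  manin_direct : directv (g + k);
  manin_nis : is_NIS B;
  manin_even : is_even_form B;
  manin_isotropic1 : is_isotropic B g;
  manin_isotropic2 : is_isotropic B k
}.

End SuperAlgebras.

Section DoubleExtension.
Variables (K : fieldType) (h : superData K) (B : h -> h -> K).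
Variables (D : 'End(h)) (a0 : h).

(* The triple (r, a, t) stands for r x + a + t x', where x' is the dual of x. *)
Definition dext_space : vectType K := (K^o * h * K^o)%type.

Definition dext_x : dext_space := (1, 0, 0).
Definition dext_xstar : dext_space := (0, 0, 1).
Definition dext_incl (a : h) : dext_space := (0, a, 0).

Fact dext_incl_is_linear : linear dext_incl.
Proof. by move=> c a b; congr (_, _, _); rewrite /= ?scaler0 ?addr0. Qed.
HB.instance Definition _ :=
  GRing.isLinear.Build K h dext_space *:%R dext_incl dext_incl_is_linear.

Definition dext_even : {vspace dext_space} :=
  (linfun dext_incl @: even_part h)%VS.
Definition dext_odd : {vspace dext_space} :=
  (<[dext_x]> + linfun dext_incl @: odd_part h + <[dext_xstar]>)%VS.

(* Bilinear extension of [x, -] = 0, [a, b] = [a, b]_h + B(D(a), b) x and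
   [x', a] = [a, x'] = D(a).  Here [x', x'] = 0, as polarizing the squaring
   dictates: s(2 x') - 2 s(x') = 0 in characteristic 2. *)
Definition dext_bracket (u v : dext_space) : dext_space :=
  let: (_, a, t) := u in
  let: (_, b, t') := v in
  (B (D a) b, bracket a b + t *: D b + t' *: D a, 0).

Definition dext_squaring (u : dext_space) : dext_space :=
  let: (_, a, t) := u in
  dext_incl (squaring a + t ^+ 2 *: a0 + t *: D a).

Definition double_extension : superData K :=
  SuperData dext_even dext_odd dext_bracket dext_squaring.

Definition dext_form (u v : double_extension) : K :=
  let: (r, a, t) := u in
  let: (r', b, t') := v in
  B a b + r * t' + t * r'.

Definition dext_sub_x (g : {vspace h}) : {vspace double_extension} :=
  (<[dext_x]> + linfun dext_incl @: g)%VS.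

(* The semidirect-product notation for this space only records that x' acts on
   k through D: K x' is a subalgebra only when s(x') = a0 vanishes. *)
Definition dext_sub_xstar (k : {vspace h}) : {vspace double_extension} :=
  (<[dext_xstar]> + linfun dext_incl @: k)%VS.

End DoubleExtension.

(* Main.v *)
Require Import Defs.
From HB Require Import structures.
From mathcomp Require Import all_boot all_order all_algebra.

Import GRing.Theory.
Local Open Scope ring_scope.

(** Write h~ for the double extension and (r, a, t) for r x + a + t x'.

    Everything rests on three facts about h that come from characteristic 2.
    The bracket of a Lie superalgebra is alternating on the whole space, not
    only on the even part ([bracket_alt]): on odd elements [x, x] is the
    polarization s(2x) - 2s(x) = 0, and the mixed terms of [e + o, e + o]
    cancel in pairs.  Hence it is symmetric.  Next, D, required to obey the
    Leibniz rule only when the first argument is even, obeys it for all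
    arguments ([derivation_bracket]), by polarizing D(s(x)) = [D(x), x].
    Finally B(D(a), D(a)) = B(a, [a0, a]) = B(a0, [a, a]) = 0
    ([form_derivation_null]).

    Given these, h~ is a Lie superalgebra.  The h-component of the squaring
    axiom for v = (r, a, t) comes down to D^2 = ad a0 and the Leibniz rule; its
    x-component leaves exactly t' B(D(a), D(a)), which is zero.  The x-component
    of each remaining axiom follows from B being invariant and even, from D
    being odd and self-adjoint, and from the first two facts.

    The form of h~ is that of h plus a hyperbolic plane spanned by x and x', and
    x, x' are distributed over the two summands, so isotropy and
    complementarity pass from (g, k) to (g~, k~).  That g~ is closed is
    immediate, as no x' occurs in it.  Closure of k~ is where the conditions on
    k enter: the x-component B(D(a), b) of a bracket vanishes because D(a) lies
    in the isotropic space k, and s(a + t x') = s(a) + t^2 a0 + t D(a) stays in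
    k because a0 and D(a) do. *)

(** * Arithmetic of bilinear maps and of vectors in characteristic 2 *)

Section Bilinear.
Context {K : fieldType} {U : lmodType K} {V : zmodType}.
Context {s s' : GRing.Scale.law K V} {f : U -> U -> V}.
Hypothesis bilf : bilinear_for s s' f.

Lemma bilinearDl (a b c : U) : f (a + b) c = f a c + f b c.
Proof.
pose L : {linear U -> V | s} :=
  HB.pack (f^~ c) (GRing.isLinear.Build K U V s (f^~ c) (bilf.1 c)).
exact: (raddfD L).
Qed.

Lemma bilinearDr (a b c : U) : f a (b + c) = f a b + f a c.
Proof.
pose L : {linear U -> V | s'} :=
  HB.pack (f a) (GRing.isLinear.Build K U V s' (f a) (bilf.2 a)).
exact: (raddfD L).
Qed.

Lemma bilinearZl (r : K) (a b : U) : f (r *: a) b = s r (f a b).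
Proof.
pose L : {linear U -> V | s} :=
  HB.pack (f^~ b) (GRing.isLinear.Build K U V s (f^~ b) (bilf.1 b)).
exact: (linearZ_LR L).
Qed.

Lemma bilinearZr (r : K) (a b : U) : f a (r *: b) = s' r (f a b).
Proof.
pose L : {linear U -> V | s'} :=
  HB.pack (f a) (GRing.isLinear.Build K U V s' (f a) (bilf.2 a)).
exact: (linearZ_LR L).
Qed.

Lemma bilinear0l (b : U) : f 0 b = 0.
Proof. by apply: (@addrI _ (f 0 b)); rewrite -bilinearDl !addr0. Qed.

Lemma bilinear0r (a : U) : f a 0 = 0.
Proof. by apply: (@addrI _ (f a 0)); rewrite -bilinearDr !addr0. Qed.

End Bilinear.

Section CharTwo.
Context {K : fieldType} (charK2 : 2%N \in [pchar K]).

Lemma addvv_pchar2 {V : lmodType K} (v : V) : v + v = 0.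
Proof. by rewrite -mulr2n -scaler_nat (pcharf0 charK2) scale0r. Qed.

Lemma oppv_pchar2 {V : lmodType K} (v : V) : - v = v.
Proof. by apply/esym/eqP; rewrite -addr_eq0 addvv_pchar2. Qed.

Lemma addv_eq0_pchar2 {V : lmodType K} (v w : V) : v + w = 0 -> v = w.
Proof. by move/eqP; rewrite addr_eq0 oppv_pchar2 => /eqP. Qed.

(** * Lie superalgebras in characteristic 2 *)

Section LieSuperalgebra.
Context {h : superData K} (lieh : is_lie_superalgebra h).
Implicit Types a b c x y : h.

Let brDl := bilinearDl (bracket_bilinear lieh).
Let brDr := bilinearDr (bracket_bilinear lieh).

Lemma parity_decomposition a :
  exists2 e, e \in even_part h & exists2 o, o \in odd_part h & a = e + o.
Proof. by apply/memv_addP; rewrite (superspace_full lieh) memvf. Qed.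

(** The odd bracket polarizes the squaring, and s(2x) = s(0) = 0. *)
Lemma bracket_odd_alt x : x \in odd_part h -> bracket x x = 0.
Proof.
move=> xo; rewrite (bracket_odd_odd lieh) // addvv_pchar2.
have -> : squaring (0 : h) = 0.
  by rewrite -[in LHS](scale0r x) (squaringZ lieh) // expr2 mul0r scale0r.
by rewrite sub0r -opprD addvv_pchar2 oppr0.
Qed.

(** The even part is alternating by axiom, the odd part by polarization, and the
    two mixed terms are equal, hence cancel in characteristic 2. *)
Lemma bracket_alt a : bracket a a = 0.
Proof.
have [e he [o ho ->]] := parity_decomposition a.
rewrite brDl !brDr (bracket_even_alt lieh) // bracket_odd_alt //.
by rewrite add0r addr0 (bracket_odd_even lieh he ho) addvv_pchar2.
Qed.

(** An alternating bilinear map is antisymmetric, and signs are trivial here. *)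
Lemma bracketC a b : bracket a b = bracket b a.
Proof.
have := bracket_alt (a + b).
rewrite brDl !brDr !bracket_alt add0r addr0; exact: addv_eq0_pchar2.
Qed.

Context {D : 'End(h)} (derD : is_derivation D).

(** The content is the case of an odd first argument.  Against an even argument
    it is the rule for even first arguments after an exchange by symmetry;
    against an odd one it is the polarization of D(s(x)) = [D(x), x]. *)
Lemma derivation_bracket a b :
  D (bracket a b) = bracket (D a) b + bracket a (D b).
Proof.
have [e he [o ho ->]] := parity_decomposition a.
rewrite !brDl !linearD /= !brDl (der_bracket derD) // addrACA; congr (_ + _).
have [e' he' [o' ho' ->]] := parity_decomposition b.
rewrite !brDr !linearD /= !brDr addrACA; congr (_ + _).
  rewrite (bracketC o) (der_bracket derD) // addrC (bracketC e').
  by rewrite (bracketC _ o).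
rewrite (bracket_odd_odd lieh) // !linearB /= !(der_squaring derD) ?memvD //.
rewrite linearD /= brDl !brDr addrA [LHS]addrAC addrK [LHS]addrC -!addrA addKr.
by rewrite (bracketC (D o')).
Qed.

Context {B : h -> h -> K} (nisB : is_NIS B) {a0 : h}.
Hypothesis D_selfadjoint : forall a b, B (D a) b = B a (D b).
Hypothesis D_square : forall a, D (D a) = bracket a0 a.

(** Moving one D across the form gives B(a, [a0, a]), which symmetry of the
    bracket and invariance turn into B(a0, [a, a]).  When a is odd, D(a) is even,
    so neither evenness of B nor alternation on odd vectors makes this value
    vanish, as the squaring axiom of the double extension requires. *)
Lemma form_derivation_null a : B (D a) (D a) = 0.
Proof.
rewrite D_selfadjoint D_square -(nis_invariant nisB) [bracket a _]bracketC.
by rewrite (nis_invariant nisB) bracket_alt (bilinear0r (nis_bilinear nisB)).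
Qed.

End LieSuperalgebra.
End CharTwo.

(** * The double extension in coordinates *)

Section DoubleExtension.
Context {K : fieldType} {h : superData K} {B : h -> h -> K} {D : 'End(h)}.
Context {a0 : h}.
Implicit Types (V : {vspace h}) (r t : K).
Local Notation dext := (double_extension B D a0).

Lemma mem_dext_incl V r a t :
  (((r, a, t) : dext) \in (linfun (@dext_incl K h) @: V)%VS)
  = [&& r == 0, a \in V & t == 0].
Proof.
apply/memv_imgP/and3P => [[b bV]|[/eqP-> aV /eqP->]].
  by rewrite lfunE /= => -[-> -> ->]; rewrite eqxx.
by exists a => //; rewrite lfunE.
Qed.

Lemma mem_dext_even r a t :
  (((r, a, t) : dext) \in even_part dext)
  = [&& r == 0, a \in even_part h & t == 0].
Proof. exact: mem_dext_incl. Qed.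

Lemma dext_addE r a t r' a' t' :
  ((r, a, t) : dext) + (r', a', t') = (r + r', a + a', t + t').
Proof. by []. Qed.

Lemma dext_scaleE c r a t :
  c *: ((r, a, t) : dext) = (c * r, c *: a, c * t).
Proof. by []. Qed.

Lemma dext_bracketE r a t r' b t' :
  bracket ((r, a, t) : dext) (r', b, t')
  = (B (D a) b, bracket a b + t *: D b + t' *: D a, 0).
Proof. by []. Qed.

Lemma dext_squaringE r a t :
  squaring ((r, a, t) : dext) = (0, squaring a + t ^+ 2 *: a0 + t *: D a, 0).
Proof. by []. Qed.

Definition dextE :=
  (dext_addE, dext_scaleE, dext_bracketE, dext_squaringE).

Lemma mem_dext_sub_x V r a t :
  (((r, a, t) : dext) \in dext_sub_x B D a0 V) = (a \in V) && (t == 0).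
Proof.
apply/memv_addP/andP => [[_ /vlineP[c ->] [[[r' b] t']]]|[aV /eqP->]].
  rewrite mem_dext_incl dext_scaleE dext_addE => /and3P[_ bV /eqP-> [_ -> ->]].
  by rewrite scaler0 add0r mulr0 addr0.
exists (r *: dext_x h); first exact/memvZ/memv_line.
exists (0, a, 0); first by rewrite mem_dext_incl eqxx aV /=.
by rewrite dext_scaleE dext_addE mulr1 scaler0 mulr0 !addr0 add0r.
Qed.

Lemma mem_dext_sub_xstar V r a t :
  (((r, a, t) : dext) \in dext_sub_xstar B D a0 V) = (r == 0) && (a \in V).
Proof.
apply/memv_addP/andP => [[_ /vlineP[c ->] [[[r' b] t']]]|[/eqP-> aV]].
  rewrite mem_dext_incl dext_scaleE dext_addE => /and3P[/eqP-> bV _ [-> -> _]].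
  by rewrite scaler0 add0r mulr0 addr0.
exists (t *: dext_xstar h); first exact/memvZ/memv_line.
exists (0, a, 0); first by rewrite mem_dext_incl eqxx aV /=.
by rewrite dext_scaleE dext_addE mulr1 scaler0 mulr0 !addr0 add0r.
Qed.

Lemma mem_dext_odd r a t :
  (((r, a, t) : dext) \in odd_part dext) = (a \in odd_part h).
Proof.
apply/memv_addP/idP => [[[[r' b] t']]|aO].
  rewrite mem_dext_sub_x => /andP[bO _] [_ /vlineP[c ->]].
  by rewrite dext_scaleE dext_addE => -[_ -> _]; rewrite scaler0 addr0.
exists (r, a, 0); first by rewrite mem_dext_sub_x aO eqxx.
exists (t *: dext_xstar h); first exact/memvZ/memv_line.
by rewrite dext_scaleE dext_addE mulr1 scaler0 mulr0 !addr0 add0r.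
Qed.

(** * The double extension is a Lie superalgebra *)

Context (charK2 : 2%N \in [pchar K]) (lieh : is_lie_superalgebra h).
Context (nisB : is_NIS B) (evenB : is_even_form B).
Context (derD : is_odd_derivation D) (a0_even : a0 \in even_part h).
Hypothesis D_selfadjoint : forall a b, B (D a) b = B a (D b).
Hypothesis D_square : forall a, D (D a) = bracket a0 a.
Hypothesis D_a0 : D a0 = 0.

Let brDl := bilinearDl (bracket_bilinear lieh).
Let brDr := bilinearDr (bracket_bilinear lieh).
Let brZl := bilinearZl (bracket_bilinear lieh).
Let brZr := bilinearZr (bracket_bilinear lieh).
Let BDl := bilinearDl (nis_bilinear nisB).
Let BDr := bilinearDr (nis_bilinear nisB).
Let BZl := bilinearZl (nis_bilinear nisB).
Let BZr := bilinearZr (nis_bilinear nisB).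
Let B0l := bilinear0l (nis_bilinear nisB).

Lemma odd_derivation_even_odd a : a \in even_part h -> D a \in odd_part h.
Proof. by case: derD => _ [/subvP D01 _] aE; apply/D01/memv_img. Qed.

Lemma odd_derivation_odd_even a : a \in odd_part h -> D a \in even_part h.
Proof. by case: derD => _ [_ /subvP D10] aO; apply/D10/memv_img. Qed.

(** D exchanges the parities and B is even, so the coefficient of x in a bracket
    of two elements of the same parity vanishes, which is what keeps brackets
    homogeneous since x is odd. *)
Lemma form_derivation_even a b :
  a \in even_part h -> b \in even_part h -> B (D a) b = 0.
Proof.
by move=> /odd_derivation_even_odd aO bE; have [] := evenB _ _ bE aO.
Qed.

Lemma form_derivation_odd a b :
  a \in odd_part h -> b \in odd_part h -> B (D a) b = 0.
Proof.
by move=> /odd_derivation_odd_even aE bO; have [] := evenB _ _ aE bO.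
Qed.

Lemma dext_bracket_bilinear : bilinear_for *:%R *:%R (@bracket K dext).
Proof.
split=> -[[r2 c] t2] k [[r a] t] [[r' b] t'].
  rewrite !dextE /= scaler0 addr0 linearP BDl BZl brDl brZl !scalerDr !scalerDl.
  rewrite !scalerA (mulrC t2); congr (_, _, _).
  by rewrite [LHS](AC (2*2*2) ((1*3*5)*(2*4*6))).
rewrite !dextE /= scaler0 addr0 linearP BDr BZr brDr brZr !scalerDr !scalerDl.
rewrite !scalerA (mulrC t2); congr (_, _, _).
by rewrite [LHS](AC (2*2*2) ((1*3*5)*(2*4*6))).
Qed.

Lemma double_extension_lie : is_lie_superalgebra dext.
Proof.
split.
- apply/eqP; rewrite eqEsubv subvf; apply/subvP => -[[r a] t] _.
  have [e eE [o oO ->]] := parity_decomposition lieh a.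
  apply/memv_addP; exists (0, e, 0); first by rewrite mem_dext_even eqxx eE /=.
  exists (r, o, t); first by rewrite mem_dext_odd.
  by rewrite dextE !add0r.
- apply/directv_addP/eqP; rewrite -subv0; apply/subvP => -[[r a] t].
  rewrite memv_cap mem_dext_even mem_dext_odd.
  case/andP=> /and3P[/eqP-> aE /eqP->] aO.
  have : a \in (even_part h :&: odd_part h)%VS by rewrite memv_cap aE.
  rewrite (directv_addP (superspace_direct lieh)) memv0 => /eqP->.
  exact: mem0v.
- exact: dext_bracket_bilinear.
- move=> [[r a] t] [[r' b] t']; rewrite !mem_dext_even.
  move=> /and3P[_ aE /eqP->] /and3P[_ bE /eqP->].
  rewrite form_derivation_even // !eqxx andbT /=.
  by rewrite !scale0r !addr0 (bracket_even_even lieh).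
- move=> [[r a] t]; rewrite mem_dext_even => /and3P[_ aE /eqP->].
  by rewrite dextE form_derivation_even // (bracket_even_alt lieh) //
    !scale0r !addr0.
- move=> [[ra a] ta] [[rb b] tb] [[rc c] tc]; rewrite !mem_dext_even.
  move=> /and3P[_ aE /eqP->] /and3P[_ bE /eqP->] /and3P[_ cE /eqP->].
  rewrite !dextE !scale0r !addr0.
  rewrite !form_derivation_even ?(bracket_even_even lieh) //.
  by rewrite (bracket_even_jacobi lieh) // !addr0.
- move=> [[r a] t] [[r' v] t']; rewrite mem_dext_even !mem_dext_odd.
  move=> /and3P[_ aE /eqP->] vO; rewrite scale0r addr0.
  by rewrite memvD ?(bracket_even_odd lieh) ?memvZ ?odd_derivation_even_odd.
- move=> [[ra a] ta] [[rb b] tb] [[r v] t]; rewrite !mem_dext_even mem_dext_odd.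
  move=> /and3P[_ aE /eqP->] /and3P[_ bE /eqP->] vO.
  rewrite (oppv_pchar2 charK2) !dextE !scale0r !addr0.
  (* The terms t B(D a, D b) and t B(D b, D a) cancel; the others match by
     invariance. *)
  rewrite (derivation_bracket charK2 lieh derD.1) !BDr !BDl !BZr.
  rewrite !brDr !brZr (bracket_module lieh) // (oppv_pchar2 charK2).
  congr (_, _, _).
    rewrite (nis_sym nisB (D b) (D a)) addrACA (addrr_pchar2 charK2) addr0.
    by rewrite (bracketC charK2 lieh a) !(nis_invariant nisB).
  rewrite scalerDr [RHS]addrACA (bracketC charK2 lieh (D a) b).
  by congr (_ + _); apply: addrC.
- move=> [[r a] t] [[r' v] t']; rewrite mem_dext_even mem_dext_odd.
  move=> /and3P[_ aE /eqP->] vO; rewrite !dextE !scale0r !addr0.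
  by rewrite D_selfadjoint (nis_sym nisB) (bracketC charK2 lieh v).
- move=> [[r a] t]; rewrite mem_dext_odd mem_dext_even => aO.
  rewrite !eqxx andbT /= !memvD ?memvZ ?(squaring_even lieh) //.
  exact: odd_derivation_odd_even.
- move=> c [[r a] t]; rewrite mem_dext_odd => aO; rewrite !dextE mulr0.
  rewrite (squaringZ lieh) // exprMn linearZ /= !scalerDr !scalerA.
  by rewrite (mulrAC c t) -expr2.
- move=> [[r a] t] [[r' b] t']; rewrite !mem_dext_odd => aO bO.
  rewrite !(oppv_pchar2 charK2) !dextE form_derivation_odd // !addr0.
  rewrite (bracket_odd_odd lieh) // !(oppv_pchar2 charK2).
  have -> : (t + t') ^+ 2 = t ^+ 2 + t' ^+ 2.
    by rewrite sqrrD mulr2n (addrr_pchar2 charK2) addr0.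
  (* Expanding s(u + v) + s(u) + s(v), whatever involves u alone or v alone,
     apart from s(a) and s(b), occurs twice. *)
  congr (_, _, _); rewrite linearD /= !scalerDr !scalerDl.
  rewrite [RHS](AC (1*2*(2*2)*3*3)
    ((1*8*11*6*5)*((2*9)*(3*12)*(4*10)*(7*13)))).
  by rewrite /= !(addvv_pchar2 charK2) !addr0.
move=> [[r a] t] [[r' b] t']; rewrite mem_dext_odd => aO.
(* D(s(v)) is [s(v), x'], and D(a0) = 0 removes its t^2 term. *)
have Ds : D (squaring a + t ^+ 2 *: a0 + t *: D a)
        = bracket (D a) a + t *: bracket a0 a.
  by rewrite !linearD !linearZ /= (der_squaring derD.1) // D_a0 scaler0 addr0
    D_square.
rewrite !dextE !scale0r !addr0 Ds; congr (_, _, _).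
  rewrite BDl !BDr BZl !BZr -D_square (D_selfadjoint (D a)).
  rewrite (form_derivation_null charK2 lieh nisB D_selfadjoint D_square).
  by rewrite /= mulr0 addr0 (nis_invariant nisB).
rewrite !brDl !brZl !brDr !brZr !linearD !linearZ /= !D_square.
rewrite (derivation_bracket charK2 lieh derD.1) (squaring_bracket lieh) //.
rewrite !scalerDr !scalerA -expr2 (bracketC charK2 lieh (D a) a) (mulrC t').
rewrite [RHS](AC (3*4) (1*6*4*(3*7)*(2*5))) /=.
by rewrite (addvv_pchar2 charK2) addr0.
Qed.

(** * The form and the two subalgebras *)

Lemma dext_form_bilinear : bilinear_for *%R *%R (@dext_form K h B D a0).
Proof.
split=> -[[r2 c] t2] k [[r a] t] [[r' b] t'].
  rewrite dext_scaleE dext_addE /= BDl BZl !mulrDl !mulrDr !mulrA.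
  by rewrite [LHS](AC (2*2*2) ((1*3*5)*(2*4*6))).
rewrite dext_scaleE dext_addE /= BDr BZr !mulrDr !mulrA.
rewrite (mulrC r2 k) (mulrC t2 k).
by rewrite [LHS](AC (2*2*2) ((1*3*5)*(2*4*6))).
Qed.

(** On both sides of the invariance identity, the x'-coefficient of each argument
    multiplies B(D(.), .) of the h-components of the other two, in an order that
    is immaterial as D is self-adjoint.  For nondegeneracy, pairing with h kills
    a, and pairing with x and x' kills t and r. *)
Lemma dext_form_NIS : is_NIS (@dext_form K h B D a0).
Proof.
split.
- exact: dext_form_bilinear.
- move=> [[r a] t] [[r' b] t'] /=.
  by rewrite (nis_sym nisB) (mulrC r) (mulrC t) addrAC.
- move=> [[r a] t]; rewrite mem_dext_odd => aO /=.
  by rewrite (nis_odd nisB aO) add0r mulrC (addrr_pchar2 charK2).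
- move=> [[ra a] ta] [[rb b] tb] [[rc c] tc]; rewrite !dextE /=.
  rewrite !BDl !BZl !BDr !BZr !D_selfadjoint (nis_invariant nisB) /=.
  rewrite !mul0r mulr0 !addr0 (mulrC _ tc).
  by rewrite [LHS](AC 4 (1*3*4*2)).
move=> [[r a] t] null.
have a_null : a = 0.
  apply: (nis_nondegenerate nisB) => b.
  by have /= := null (0, b, 0); rewrite !mulr0 !addr0.
have /= := null (dext_x h); have /= := null (dext_xstar h).
by rewrite a_null !B0l !mulr0 !mulr1 !addr0 !add0r => -> ->.
Qed.

Lemma dext_form_even : is_even_form (@dext_form K h B D a0).
Proof.
move=> [[r a] t] [[r' b] t']; rewrite mem_dext_even mem_dext_odd.
move=> /and3P[/eqP-> aE /eqP->] bO /=.
by have [-> ->] := evenB _ _ aE bO; rewrite !mul0r !mulr0 !addr0.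
Qed.

Lemma graded_decomposition V a :
    is_lie_subsuperalgebra V -> a \in V ->
  exists2 e, (e \in V) && (e \in even_part h) &
  exists2 o, (o \in V) && (o \in odd_part h) & a = e + o.
Proof.
move=> subV; rewrite -{1}(sub_graded subV) => /memv_addP[e eV [o oV ->]].
by exists e; [rewrite -memv_cap | exists o; rewrite -?memv_cap].
Qed.

(** Without an x' component, D enters brackets only through the coefficient of
    x, which is free in this space. *)
Lemma dext_sub_x_lie V :
  is_lie_subsuperalgebra V -> is_lie_subsuperalgebra (dext_sub_x B D a0 V).
Proof.
move=> subV; split.
- apply/eqP; rewrite eqEsubv subv_add !capvSl /=; apply/subvP => -[[r a] t].
  rewrite mem_dext_sub_x => /andP[aV /eqP->].
  have [e /andP[eV eE] [o /andP[oV oO] ->]] := graded_decomposition _ _ subV aV.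
  apply/memv_addP; exists (0, e, 0).
    by rewrite memv_cap mem_dext_even mem_dext_sub_x eV eE eqxx.
  exists (r, o, 0).
    by rewrite memv_cap mem_dext_odd mem_dext_sub_x oV oO eqxx.
  by rewrite dextE !add0r.
- move=> [[r a] t] [[r' b] t']; rewrite !mem_dext_sub_x.
  move=> /andP[aV /eqP->] /andP[bV /eqP->].
  by rewrite !scale0r !addr0 eqxx andbT (sub_bracket subV).
move=> [[r a] t]; rewrite mem_dext_odd !mem_dext_sub_x => /andP[aV /eqP->] aO.
by rewrite expr2 mulr0 !scale0r !addr0 eqxx andbT (sub_squaring subV).
Qed.

(** Dually, brackets must have no component on x, which isotropy ensures since
    D(V) is inside V; the square of x' forces a0 to be in V. *)
Lemma dext_sub_xstar_lie V :
    is_lie_subsuperalgebra V -> is_isotropic B V -> (D @: V <= V)%VS ->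
    a0 \in V ->
  is_lie_subsuperalgebra (dext_sub_xstar B D a0 V).
Proof.
move=> subV isoV /subvP DV a0V.
have D_V a : a \in V -> D a \in V by move=> aV; apply/DV/memv_img.
split.
- apply/eqP; rewrite eqEsubv subv_add !capvSl /=; apply/subvP => -[[r a] t].
  rewrite mem_dext_sub_xstar => /andP[/eqP-> aV].
  have [e /andP[eV eE] [o /andP[oV oO] ->]] := graded_decomposition _ _ subV aV.
  apply/memv_addP; exists (0, e, 0).
    by rewrite memv_cap mem_dext_even mem_dext_sub_xstar eV eE eqxx.
  exists (0, o, t).
    by rewrite memv_cap mem_dext_odd mem_dext_sub_xstar oV oO eqxx.
  by rewrite dextE !add0r.
- move=> [[r a] t] [[r' b] t']; rewrite !mem_dext_sub_xstar.
  move=> /andP[_ aV] /andP[_ bV].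
  by rewrite isoV ?D_V // eqxx !memvD ?memvZ ?D_V ?(sub_bracket subV).
move=> [[r a] t]; rewrite mem_dext_odd !mem_dext_sub_xstar => /andP[_ aV] aO.
by rewrite eqxx !memvD ?memvZ ?D_V ?(sub_squaring subV).
Qed.

End DoubleExtension.

(** * The extended Manin triple *)

Theorem theorem4p2p3 (K : fieldType) (charK2 : 2%N \in [pchar K])
    (h : superData K) (B : h -> h -> K) (g k : {vspace h})
    (manin_hgk : is_manin_triple_with B g k)
    (D : 'End(h)) (a0 : h)
    (derD : is_odd_derivation D)
    (a0_even : a0 \in even_part h)
    (D_selfadjoint : forall a b : h, B (D a) b = B a (D b))
    (D_square : forall a : h, D (D a) = bracket a0 a)
    (D_a0 : D a0 = 0)
    (D_k : (D @: k <= k)%VS)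
    (a0_k : a0 \in k) :
  is_manin_triple_with (@dext_form K h B D a0)
    (dext_sub_x B D a0 g) (dext_sub_xstar B D a0 k).
Proof.
case: manin_hgk => lieh sub_g sub_k full direct nisB evenB iso_g iso_k.
split.
- exact: double_extension_lie.
- exact: dext_sub_x_lie.
- exact: dext_sub_xstar_lie.
- apply/eqP; rewrite eqEsubv subvf; apply/subvP => -[[r a] t] _.
  have /memv_addP[b bg [c ck ->]] : a \in (g + k)%VS by rewrite full memvf.
  apply/memv_addP; exists (r, b, 0); first by rewrite mem_dext_sub_x bg eqxx.
  exists (0, c, t); first by rewrite mem_dext_sub_xstar ck eqxx.
  by rewrite dextE addr0 add0r.
- apply/directv_addP/eqP; rewrite -subv0; apply/subvP => -[[r a] t].
  rewrite memv_cap mem_dext_sub_x mem_dext_sub_xstar.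
  case/andP=> /andP[ag /eqP->] /andP[/eqP-> ak].
  have : a \in (g :&: k)%VS by rewrite memv_cap ag.
  by rewrite (directv_addP direct) memv0 => /eqP->; apply: mem0v.
- exact: dext_form_NIS.
- exact: dext_form_even.
- move=> [[r a] t] [[r' b] t']; rewrite !mem_dext_sub_x.
  move=> /andP[ag /eqP->] /andP[bg /eqP->] /=.
  by rewrite iso_g // mulr0 mul0r !addr0.
move=> [[r a] t] [[r' b] t']; rewrite !mem_dext_sub_xstar.
move=> /andP[/eqP-> ak] /andP[/eqP-> bk] /=.
by rewrite iso_k // mulr0 mul0r !addr0.
Qed.
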